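(* For the weight $w(k)=\frac{(a_1)_k\cdots(a_M)_k}{k!\,(b_1)_k\cdots(b_N)_k}\eta^k$, $k\in\mathbb N_0$, let $r,s$ be two different parameters taken from $\{a_1,\dots,a_M,b_1,\dots,b_N\}$, and let $u_n=H_{n-1}$, $n\in\mathbb N$, be the squared norms of the corresponding monic orthogonal polynomials, regarded as functions of $(n,r,s)$. Then, with the shifts $\bar{\ },\hat{\ },\tilde{\ }$ in $n,r,s$ defined in the context, the squared norms satisfy, for all $n\in\mathbb N$, the nonlinear equation linking contiguous hypergeometric parameters $$\frac{\hat{\bar u}_n-\tilde{\bar u}_n}{\bar u_n}=\tilde{\hat u}_n\Big(\frac1{\tilde u_n}-\frac1{\hat u_n}\Big).$$
   Context: $\mathbb N=\{1,2,\dots\}$, $\mathbb N_0=\{0,1,2,\dots\}$, and $(\alpha)_k=\alpha(\alpha+1)\cdots(\alpha+k-1)$. The moments are $\rho_n=\sum_{k=0}^\infty k^nw(k)$, $G=(\rho_{n+m})_{n,m\in\mathbb N_0}$, and $P_n$ are the monic orthogonal polynomials, with $\sum_{k=0}^\infty P_n(k)P_m(k)w(k)=\delta_{n,m}H_n$, $H_n\ne0$; equivalently $G=S^{-1}HS^{-\top}$ with $S$ lower unitriangular and $H=\operatorname{diag}(H_0,H_1,\dots)$. It is assumed that for the given and the shifted parameters appearing below the moments converge and all leading principal minors of the moment matrix are nonzero, and that the constants $\hat a,\tilde a$ below are nonzero. Shifts: $\bar u_n(r,s)=u_{n+1}(r,s)$, $\hat u_n(r,s)=\hat a\,u_n(r\pm1,s)$,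 $\tilde u_n(r,s)=\tilde a\,u_n(r,s\pm1)$, with all other parameters fixed. The sign is $+$ if the shifted variable is one of the $a_i$ and $-$ if it is one of the $b_j$. The constant $\hat a$ equals $a_i$ if $r=a_i$ and $b_j-1$ if $r=b_j$; similarly $\tilde a$ equals $a_i$ if $s=a_i$ and $b_j-1$ if $s=b_j$. Composite decorations denote the composition of these operations; e.g. $\tilde{\hat u}_n=\tilde a\hat a\,u_n(r\pm1,s\pm1)$, $\hat{\bar u}_n=\hat a\,u_{n+1}(r\pm1,s)$, $\tilde{\bar u}_n=\tilde a\,u_{n+1}(r,s\pm1)$. *)

(* Defs.v *)
(* MathComp / MathComp-Analysis *)
From HB Require Import structures.
From mathcomp Require Export all_boot all_order all_algebra complex.
From mathcomp Require Export boolp classical_sets functions reals topology.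
From mathcomp Require Export normedtype sequences.
Export Order.TTheory GRing.Theory Num.Theory.
Export numFieldNormedType.Exports.

#[export] Set Implicit Arguments.
#[export] Unset Strict Implicit.
#[export] Unset Printing Implicit Defensive.

#[global] Open Scope classical_set_scope.
#[global] Open Scope complex_scope.
#[global] Open Scope ring_scope.

Definition pochhammer (K : numFieldType) (x : K) (k : nat) : K :=
  \prod_(i < k) (x + i%:R).

Section Orthogonality.
Variables (K : numFieldType) (w : nat -> K).

(* Only meaningful together with the convergence of the series: limn takes an
   arbitrary value on a divergent sequence. *)
Definition sum_wrt (f : nat -> K) : K := limn (series (fun k => f k * w k)).

Definition moments_converge : Prop :=
  forall n : nat, cvgn (series (fun k => k%:R ^+ n * w k)).

Definition moment (n : nat) : K := sum_wrt (fun k => k%:R ^+ n).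

Definition moment_mx (n : nat) : 'M[K]_n := \matrix_(i, j) moment (i + j).

Definition minors_nonzero : Prop := forall n : nat, \det (moment_mx n) != 0.

(* size p = n.+1 means that p has degree n. *)
Definition is_monic_ops (P : nat -> {poly K}) : Prop :=
  [/\ forall n, P n \is monic /\ size (P n) = n.+1,
      forall n m, n != m -> sum_wrt (fun k => (P n).[k%:R] * (P m).[k%:R]) = 0 &
      forall n, sum_wrt (fun k => (P n).[k%:R] * (P n).[k%:R]) != 0].

(* The default value 0 is irrelevant when the moments converge and the leading
   principal minors do not vanish: there is then exactly one such family. *)
Definition monic_ops : nat -> {poly K} := xget (fun=> 0) [set P | is_monic_ops P].

Definition sqnorm (n : nat) : K :=
  sum_wrt (fun k => (monic_ops n).[k%:R] * (monic_ops n).[k%:R]).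

End Orthogonality.

Section Hypergeometric.
Variables (K : numFieldType) (M N : nat).

(* c (inl i) is the i-th upper parameter a_i and c (inr j) the j-th lower
   parameter b_j. *)
Definition parameters := 'I_M + 'I_N -> K.

Definition weight (eta : K) (c : parameters) (k : nat) : K :=
  (\prod_(i < M) pochhammer (c (inl i)) k) /
  (k`!%:R * \prod_(j < N) pochhammer (c (inr j)) k) * eta ^+ k.

(* The first conjunct says that no denominator of the weight vanishes, i.e.
   that no b_j is zero or a negative integer. *)
Definition admissible (eta : K) (c : parameters) : Prop :=
  [/\ forall (j : 'I_N) (k : nat), pochhammer (c (inr j)) k != 0,
      moments_converge (weight eta c) &
      minors_nonzero (weight eta c)].

Definition shift_param (p : 'I_M + 'I_N) (c : parameters) : parameters :=
  fun q => if q == p then (if p is inl _ then c q + 1 else c q - 1) else c q.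

Definition shift_const (p : 'I_M + 'I_N) (c : parameters) : K :=
  if p is inl _ then c p else c p - 1.

(* Functions of the discrete variable n and of all the hypergeometric
   parameters, and the shifts acting on them. *)
Definition lattice_fun := nat -> parameters -> K.

Definition n_shift (u : lattice_fun) : lattice_fun := fun n c => u n.+1 c.

Definition p_shift (p : 'I_M + 'I_N) (u : lattice_fun) : lattice_fun :=
  fun n c => shift_const p c * u n (shift_param p c).

(* H_(n-1); only the values at n >= 1 are relevant. *)
Definition norm_fun (eta : K) : lattice_fun :=
  fun n c => sqnorm (weight eta c) n.-1.

End Hypergeometric.

(* Main.v *)
(** For a parameter [p] the shift turns the weight [w(k)] into [(k + a) w(k)]
    up to the factor [a := shift_const p c], so every norm in the equation is
    that of a functional [L(p)], [L((x + a) p)], [L((x + b) p)] or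
    [L((x + a)(x + b) p)].  If [P] and [Q] are the monic orthogonal polynomials
    of [L] and of [L((x + a) .)], then Christoffel's formula reads
    [(x + a) Q_n = P_(n+1) + (|Q_n|^2 / |P_n|^2) P_n].  Its coefficient of
    degree [n] expresses the ratio of norms through the subleading coefficients
    of [P] and [Q]; substituting this in both sides of the equation, everything
    cancels. *)
Require Import Defs.
From HB Require Import structures.
From mathcomp Require Import ring.

(** * Orthogonal polynomials of an abstract linear functional *)

Section OrthogonalPolynomials.
Variable K : fieldType.
Implicit Types (L : {scalar {poly K}}) (P Q : nat -> {poly K}).

Definition orthogonal_family L P : Prop :=
  [/\ forall n, P n \is monic /\ size (P n) = n.+1,
      forall n m, n != m -> L (P n * P m) = 0 &
      forall n, L (P n * P n) != 0].

Lemma scalar_mul_eq0 L (q : {poly K}) n :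
    (forall i, (i < n)%N -> L ('X^i * q) = 0) ->
  forall p : {poly K}, (size p <= n)%N -> L (p * q) = 0.
Proof.
move=> Lq p sp; rewrite [p](_ : _ = \poly_(i < n) p`_i); last first.
  apply/polyP => i; rewrite coef_poly; case: ltnP => // ni.
  by rewrite nth_default // (leq_trans sp).
rewrite poly_def mulr_suml linear_sum big1 // => i _.
by rewrite -scalerAl linearZ /= Lq ?mulr0.
Qed.

Lemma monic_sub_size (p q : {poly K}) n :
  q \is monic -> size q = n.+1 -> (size p <= n.+1)%N ->
  (size (p - p`_n *: q)%R <= n)%N.
Proof.
move=> /monicP; rewrite /lead_coef => + sq sp; rewrite sq /= => qn.
apply/leq_sizeP => i; rewrite leq_eqVlt coefB coefZ => /predU1P[<-|ni].
  by rewrite qn mulr1 subrr.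
by rewrite (nth_default _ (leq_trans sp ni)) [q`_i]nth_default ?sq // mulr0 subrr.
Qed.

Lemma orthogonal_low L P n (p : {poly K}) : orthogonal_family L P ->
  (size p <= n)%N -> L (p * P n) = 0.
Proof.
case=> Pn PP _.
(* [P n] stays fixed while the degree bound [m] drops: each step peels off a multiple of some [P m]
   with [m < n]. *)
suff low m : (m <= n)%N -> (size p <= m)%N -> L (p * P n) = 0 by exact: low.
elim: m p => [|m IHm] p mn sp.
  by move: sp; rewrite leqn0 size_poly_eq0 => /eqP ->; rewrite mul0r linear0.
have [Pm sPm] := Pn m.
rewrite -[p](subrK (p`_m *: P m)) mulrDl linearD /= IHm ?(ltnW mn) //.
  by rewrite add0r -scalerAl linearZ /= PP ?mulr0 // neq_ltn mn.
exact: monic_sub_size.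
Qed.

Lemma orthogonal_coef L P n (p : {poly K}) : orthogonal_family L P ->
  (size p <= n.+1)%N -> L (p * P n) = p`_n * L (P n * P n).
Proof.
move=> LP sp; have [Pn _ _] := LP; have [Pm sPm] := Pn n.
rewrite -{1}[p](subrK (p`_n *: P n)) mulrDl linearD /=.
rewrite (orthogonal_low LP) ?monic_sub_size // add0r -scalerAl linearZ //.
Qed.

Lemma monic_coef_size (p : {poly K}) n :
  p \is monic -> size p = n.+1 -> p`_n = 1.
Proof. by move=> /monicP <- sp; rewrite lead_coefE sp. Qed.

(* The subleading coefficient of [Q n] is written [('X * Q n)`_n], so that it is
   0 for [n = 0]. *)
Lemma christoffel_norm L (L' : {scalar {poly K}}) (a : K) P Q n :
    (forall p, L' p = L (p * ('X + a%:P))) ->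
    orthogonal_family L P -> orthogonal_family L' Q ->
  L' (Q n * Q n) / L (P n * P n) =
    a + ('X * Q n)`_n - ('X * P n.+1)`_n.+1.
Proof.
move=> L'E LP LQ; have [Pm PP Pn0] := LP; have [Qm _ _] := LQ.
have [Pmn sPn] := Pm n; have [Pmn1 sPn1] := Pm n.+1; have [Qmn sQn] := Qm n.
(* Both terms are monic of degree [n.+1], so [D] has degree at most [n]; its coefficient of degree
   [n] is the right-hand side. *)
pose D := Q n * ('X + a%:P) - P n.+1.
have Dn : D`_n = a + ('X * Q n)`_n - ('X * P n.+1)`_n.+1.
  rewrite coefB mulrDr coefD coefMC (monic_coef_size Qmn sQn) mul1r.
  by rewrite [('X * P _)`__]coefXM [Q n * 'X]mulrC [a + _]addrC.
have mX : ('X + a%:P : {poly K}) \is monic by rewrite monicXaddC.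
have sQX : size (Q n * ('X + a%:P)) = n.+2.
  by rewrite size_monicM ?monic_neq0 // sQn size_XaddC addn2.
have sD : (size D <= n.+1)%N.
  have <- : Q n * ('X + a%:P) - (Q n * ('X + a%:P))`_n.+1 *: P n.+1 = D.
    by rewrite (monic_coef_size _ sQX) ?scale1r // monicMl.
  by rewrite monic_sub_size ?sQX.
(* [L (D * P n)] is computed in two ways. Directly, [P n.+1] drops out and the factor ['X + a%:P]
   turns [L] into [L']; there [P n], being monic of degree [n], pairs with [Q n] to give the norm of
   [Q n]. *)
apply: (mulIf (Pn0 n)); rewrite divfK // -Dn -(orthogonal_coef LP sD).
rewrite mulrBl linearB /= PP ?subr0 //; last by rewrite neq_ltn ltnSn orbT.
rewrite mulrAC -L'E [_ * P n]mulrC [RHS](orthogonal_coef LQ) ?sPn //.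
by rewrite (monic_coef_size Pmn) // mul1r.
Qed.

(** Both sides equal [a - b] plus the difference of the subleading coefficients of [Pa n.+1] and
    [Pb n.+1]; those of [P n.+2] and of [Pab n] cancel. *)
Lemma norm_equation L (La Lb Lab : {scalar {poly K}}) (a b : K)
    P (Pa Pb Pab : nat -> {poly K}) n :
    (forall p, La p = L (p * ('X + a%:P))) ->
    (forall p, Lb p = L (p * ('X + b%:P))) ->
    (forall p, Lab p = Lb (p * ('X + a%:P))) ->
    orthogonal_family L P -> orthogonal_family La Pa ->
    orthogonal_family Lb Pb -> orthogonal_family Lab Pab ->
  (La (Pa n.+1 * Pa n.+1) - Lb (Pb n.+1 * Pb n.+1)) / L (P n.+1 * P n.+1) =
  Lab (Pab n * Pab n) * ((Lb (Pb n * Pb n))^-1 - (La (Pa n * Pa n))^-1).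
Proof.
move=> LaE LbE LabE LP LPa LPb LPab.
(* The two linear factors commute, so [Lab] is a Christoffel transform of [La] as well as of
   [Lb]. *)
have LabE' p : Lab p = La (p * ('X + b%:P)).
  by rewrite LabE LbE LaE mulrAC.
rewrite mulrBl mulrBr (christoffel_norm _ LaE LP LPa).
rewrite (christoffel_norm _ LbE LP LPb) (christoffel_norm _ LabE LPb LPab).
rewrite (christoffel_norm _ LabE' LPa LPab); ring.
Qed.

(** Invertibility of the moment matrix of size [n] yields [P n]; that of size [n.+1] makes its norm
    nonzero. *)
Lemma orthogonal_family_exists L :
    (forall n, \det (\matrix_(i < n, j < n) L 'X^(i + j)) != 0) ->
  exists P, orthogonal_family L P.
Proof.
move=> det0.
have step n : exists p : {poly K}, [/\ p \is monic, size p = n.+1 &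
    forall i, (i < n)%N -> L ('X^i * p) = 0].
  set G := \matrix_(i < n, j < n) L 'X^(i + j).
  have Gu : G \in unitmx by rewrite unitmxE unitfE det0.
  (* The lower coefficients of [P n] solve the linear system saying that ['X^n + q] is orthogonal to
     all ['X^i] with [i < n]. *)
  pose v : 'rV[K]_n := - (\row_j L 'X^(n + j)) *m invmx G.
  pose q := \sum_(j < n) v 0 j *: 'X^j.
  have sq : (size q < size ('X^n : {poly K}))%N.
    rewrite size_polyXn ltnS; apply: (leq_trans (size_sum _ _ _)).
    apply/bigmax_leqP => j _; apply: (leq_trans (size_scale_leq _ _)).
    by rewrite size_polyXn.
  exists ('X^n + q); split.
  - by rewrite monicE lead_coefDl // lead_coefXn.
  - by rewrite size_polyDl // size_polyXn.
  move=> i ni; have : (v *m G) 0 (Ordinal ni) = - L 'X^(n + i).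
    by rewrite mulmxKV // !mxE.
  rewrite mxE => vG; rewrite mulrDr linearD /= -exprD mulr_sumr linear_sum.
  rewrite (eq_bigr (fun j => v 0 j * G j (Ordinal ni))).
    by rewrite vG addnC subrr.
  by move=> j _; rewrite [G _ _]mxE -scalerAr linearZ /= -exprD addnC.
have [P PE] := choice step.
have low n (p : {poly K}) : (size p <= n)%N -> L (p * P n) = 0.
  by apply: scalar_mul_eq0; have [] := PE n.
exists P; split=> [n|n m|n]; first by have [] := PE n.
  rewrite neq_ltn => /orP[nm|mn].
    by apply: low; have [_ -> _] := PE n.
  by rewrite mulrC; apply: low; have [_ -> _] := PE m.
(* If the norm vanished, [P n] would be orthogonal to ['X^n] too, and its coefficients, the last of
   which is 1, would form a kernel vector of the moment matrix of size [n.+1]. *)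
have [Pm sP _] := PE n; apply/negP => /eqP PP0.
have/negP := det0 n.+1; apply; apply/det0P.
exists (\row_j (P n)`_j).
  apply/eqP => /rowP /(_ ord_max); rewrite !mxE /= (monic_coef_size Pm) //.
  by move/eqP; rewrite oner_eq0.
apply/rowP => j; rewrite !mxE.
transitivity (L ('X^j * P n)).
  have -> : 'X^j * P n = \sum_(i < n.+1) (P n)`_i *: 'X^(i + j).
    rewrite -[in LHS](coefK (P n)) sP poly_def mulr_sumr; apply: eq_bigr => i _.
    by rewrite -scalerAr -exprD addnC.
  by rewrite linear_sum; apply: eq_bigr => i _; rewrite !mxE linearZ.
have := ltn_ord j; rewrite ltnS leq_eqVlt => /predU1P[->|jn]; last first.
  by apply: low; rewrite size_polyXn.
rewrite -[_ * _](subrK (P n * P n)) -mulrBl linearD /= PP0 addr0; apply: low.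
have <- : 'X^n - ('X^n : {poly K})`_n *: P n = 'X^n - P n.
  by rewrite coefXn eqxx scale1r.
by rewrite monic_sub_size // size_polyXn.
Qed.

(** Absorbs the constants of the parameter shifts: every norm is multiplied by [x], and for [x != 0]
    the orthogonal family is unchanged. *)
Definition scale_functional (x : K) L (p : {poly K}) : K := x * L p.

Lemma scale_functional_is_scalar x L : scalar (scale_functional x L).
Proof.
by move=> a p q; rewrite /scale_functional linearP mulrDr mulrCA.
Qed.

HB.instance Definition _ x L := GRing.isLinear.Build K {poly K} K *%R
  (scale_functional x L) (scale_functional_is_scalar x L).

Lemma orthogonal_family_scale x L P : x != 0 ->
  orthogonal_family L P -> orthogonal_family (scale_functional x L) P.
Proof.
move=> x0 [PE PP P0]; split=> // [n m nm|n]; rewrite /= /scale_functional.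
  by rewrite PP ?mulr0.
by rewrite mulf_neq0.
Qed.

End OrthogonalPolynomials.

(** * The functional of a weight with convergent moments *)

Section MomentFunctional.
Variables (K : numFieldType) (w : nat -> K) (cw : moments_converge w).

Lemma cvg_poly_series (p : {poly K}) :
  cvgn (series (fun k => p.[k%:R] * w k)).
Proof.
rewrite -(coefK p) poly_def.
elim/big_ind: _ => [|p1 p2 cp1 cp2|i _].
- under eq_fun do rewrite horner0 mul0r.
  have -> : (fun=> 0) = 0 *: (fun k => k%:R ^+ 0 * w k) :> (nat -> K).
    by apply/funext => k; rewrite scale0r.
  by apply: is_cvg_seriesZ; apply: cw.
- under eq_fun do rewrite hornerD mulrDl.
  exact: is_cvg_seriesD.
under eq_fun do rewrite hornerZ hornerXn -mulrA.
by apply: is_cvg_seriesZ; apply: cw.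
Qed.

(* The argument [cw] is a phantom on which the linear structure depends. *)
Definition moment_functional (_ : moments_converge w) (p : {poly K}) : K :=
  sum_wrt w (fun k => p.[k%:R]).

Lemma moment_functional_is_scalar : scalar (moment_functional cw).
Proof.
move=> a p q; rewrite /moment_functional /sum_wrt.
rewrite -[a * _]/(a *: _) -lim_seriesZ; last exact: cvg_poly_series.
rewrite -lim_seriesD; last exact: cvg_poly_series.
  by congr (limn (series _)); apply/funext => k; rewrite !hornerE mulrDl -mulrA.
by apply: is_cvg_seriesZ; exact: cvg_poly_series.
Qed.

HB.instance Definition _ := GRing.isLinear.Build K {poly K} K *%R
  (moment_functional cw) moment_functional_is_scalar.

Lemma orthogonal_monic_ops P :
  orthogonal_family (moment_functional cw) P <-> is_monic_ops w P.
Proof.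
have E n m : moment_functional cw (P n * P m) =
    sum_wrt w (fun k => (P n).[k%:R] * (P m).[k%:R]).
  by congr (sum_wrt _ _); apply/funext => k; rewrite hornerM.
split=> -[PE PP P0]; split=> // [n m /PP|n].
- exact/etrans/esym/E.
- by apply: contra_neq (P0 n) => /(etrans (E n n)).
- exact/etrans/E.
- by apply: contra_neq (P0 n) => /(etrans (esym (E n n))).
Qed.

(** Existence ensures that [xget] picks a genuine orthogonal family and not its default value. *)
Lemma orthogonal_family_monic_ops : minors_nonzero w ->
  orthogonal_family (moment_functional cw) (monic_ops w).
Proof.
move=> mw; apply/orthogonal_monic_ops.
have [|P /orthogonal_monic_ops PE] :=
  @orthogonal_family_exists _ (moment_functional cw).
  move=> n; have := mw n; congr (\det _ != 0).
  apply/matrixP => i j; rewrite !mxE; congr (sum_wrt _ _).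
  by apply/funext => k; rewrite hornerXn.
by apply: (@xgetPex _ (fun=> 0) [set P | is_monic_ops w P]); exists P.
Qed.

Lemma sqnormE : sqnorm w =
  fun n => moment_functional cw (monic_ops w n * monic_ops w n).
Proof.
by apply/funext => n; congr (sum_wrt _ _); apply/funext => k; rewrite hornerM.
Qed.

End MomentFunctional.

(** * Effect of a parameter shift on the weight and its functional *)

Lemma moment_functional_scale (K : numFieldType) (w w' : nat -> K) (x a : K)
    (cw : moments_converge w) (cw' : moments_converge w') (p : {poly K}) :
    (forall k, x * w' k = (k%:R + a) * w k) ->
  x * moment_functional cw' p = moment_functional cw (p * ('X + a%:P)).
Proof.
move=> w'E; rewrite /moment_functional /sum_wrt -[x * _]/(x *: _).
rewrite -lim_seriesZ; last exact: cvg_poly_series.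
congr (limn (series _)); apply/funext => k.
by rewrite !hornerE /= -mulrA -w'E -[LHS]/(x * _) mulrCA.
Qed.

(** Both sides are [pochhammer x k.+1], split at its first and at its last factor. *)
Lemma pochhammerS_shift (K : numFieldType) (x : K) k :
  x * pochhammer (x + 1) k = pochhammer x k * (x + k%:R).
Proof.
transitivity (pochhammer x k.+1); last exact: big_ord_recr.
rewrite /pochhammer [RHS]big_ord_recl.
rewrite addr0; congr (_ * _); apply: eq_bigr => i _.
by rewrite /bump /= natrD addrA.
Qed.

Lemma weight_shift (K : numFieldType) (M N : nat) (eta : K)
    (c : parameters K M N) (p : 'I_M + 'I_N) (k : nat) :
    (forall j i, pochhammer (c (inr j)) i != 0) ->
    (forall j i, pochhammer (shift_param p c (inr j)) i != 0) ->
  shift_const p c * weight eta (shift_param p c) k =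
  (k%:R + shift_const p c) * weight eta c k.
Proof.
rewrite /weight; case: p => [i|j] c0 sc0.
  rewrite (bigD1 i) //= [in RHS](bigD1 i) //= {1}/shift_param eqxx.
  rewrite (eq_bigr (fun i0 => pochhammer (c (inl i0)) k)); last first.
    by move=> i0 ne; rewrite /shift_param (inj_eq inl_inj) (negbTE ne).
  rewrite !mulrA pochhammerS_shift [_ + k%:R]addrC.
  by rewrite [pochhammer _ _ * _]mulrC.
rewrite [in LHS](bigD1 j) //= [in RHS](bigD1 j) //=.
have := sc0 j k; have := c0 j k.
have := pochhammerS_shift (c (inr j) - 1) k.
rewrite {1 3}/shift_param eqxx subrK.
rewrite (eq_bigr (fun j0 => pochhammer (c (inr j0)) k)); last first.
  by move=> i0 ne; rewrite /shift_param (inj_eq inr_inj) (negbTE ne).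
set A := \prod_(i < M) _; set B := \prod_(i < N | _) _.
set y := pochhammer _ k; set z := pochhammer _ k => E y0 z0.
have B0 : B != 0 by apply/prodf_neq0 => i _; apply: c0.
have f0 : k`!%:R != 0 :> K by rewrite pnatr_eq0 -lt0n fact_gt0.
(* For a lower parameter the Pochhammer identity is taken at [c (inr j) - 1] and divided by the two
   denominators [y] and [z]. *)
have {}E : (c (inr j) - 1) / z = (k%:R + (c (inr j) - 1)) / y.
  by apply/eqP; rewrite eqr_div // E mulrC [k%:R + _]addrC.
transitivity ((c (inr j) - 1) / z * (A / (k`!%:R * B) * eta ^+ k)).
  by field; apply/and3P.
by rewrite E; field; apply/and3P.
Qed.

Lemma contiguous_norm_equation (K : numFieldType) (M N : nat) (eta : K)
    (c : parameters K M N) (r s : 'I_M + 'I_N)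
    (rs : r != s)
    (adm : admissible eta c)
    (adm_r : admissible eta (shift_param r c))
    (adm_s : admissible eta (shift_param s c))
    (adm_rs : admissible eta (shift_param r (shift_param s c)))
    (const_r : shift_const r c != 0)
    (const_s : shift_const s c != 0)
    (n : nat) (n_gt0 : (0 < n)%N) :
  let u := norm_fun (M := M) (N := N) eta in
  let bar := @n_shift K M N in
  let hat := p_shift r in
  let tilde := p_shift s in
  (hat (bar u) n c - tilde (bar u) n c) / bar u n c =
  tilde (hat u) n c * (1 / tilde u n c - 1 / hat u n c).
Proof.
(* [norm_fun] reads [n.-1]; replacing [n] by [n.+1] removes the predecessor. *)
move=> u bar hat tilde; case: n n_gt0 => // n _.
(* As [r] and [s] differ, the shift in [s] leaves the constant of [r] alone. *)
have const_rs : shift_const r (shift_param s c) = shift_const r c.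
  by rewrite /shift_const /shift_param (negbTE rs).
case: adm adm_r adm_s adm_rs => [b0 cw mw] [br0 cwr mwr] [bs0 cws mws].
case=> [brs0 cwrs mwrs].
rewrite /hat /tilde /bar /u /p_shift /n_shift /norm_fun /= const_rs.
rewrite (sqnormE cw) (sqnormE cwr) (sqnormE cws) (sqnormE cwrs).
(* With the constants inside the functionals, the goal is [norm_equation] up to conversion. The
   nesting in [Lab] follows the order of [tilde (hat u)]. *)
pose L := moment_functional cw.
pose La := scale_functional (shift_const r c) (moment_functional cwr).
pose Lb := scale_functional (shift_const s c) (moment_functional cws).
pose Lab := scale_functional (shift_const s c)
  (scale_functional (shift_const r c) (moment_functional cwrs)).
rewrite !div1r; apply: (@norm_equation _ L La Lb Lab
  (shift_const r c) (shift_const s c)).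
- move=> p; apply: moment_functional_scale => k; exact: weight_shift.
- move=> p; apply: moment_functional_scale => k; exact: weight_shift.
- move=> p; congr (_ * _); apply: moment_functional_scale => k.
  by rewrite -const_rs; apply: weight_shift.
- exact: orthogonal_family_monic_ops.
- by apply: orthogonal_family_scale => //; apply: orthogonal_family_monic_ops.
- by apply: orthogonal_family_scale => //; apply: orthogonal_family_monic_ops.
do 2!apply: orthogonal_family_scale => //.
exact: orthogonal_family_monic_ops.
Qed.

Theorem theorem5 (R : realType) (M N : nat) (eta : R[i])
    (c : parameters R[i] M N) (r s : 'I_M + 'I_N)
    (rs : r != s)
    (adm : admissible eta c)
    (adm_r : admissible eta (shift_param r c))
    (adm_s : admissible eta (shift_param s c))
    (adm_rs : admissible eta (shift_param r (shift_param s c)))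
    (const_r : shift_const r c != 0)
    (const_s : shift_const s c != 0)
    (n : nat) (n_gt0 : (0 < n)%N) :
  let u := norm_fun (M := M) (N := N) eta in
  let bar := @n_shift R[i] M N in
  let hat := p_shift r in
  let tilde := p_shift s in
  (hat (bar u) n c - tilde (bar u) n c) / bar u n c =
  tilde (hat u) n c * (1 / tilde u n c - 1 / hat u n c).
Proof.
(* Otherwise unification expands the field structure of [R[i]] and does not
   return in reasonable time. *)
unfold reverse_coercion in *; exact: contiguous_norm_equation.
Qed.
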